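(* Let $S$ be the second filtration of the surjection operad over $\mathbb{F}_2$ (the cacti model described in the context). Put $\pi(m)=12$, $\pi(b)=121+212$, $\pi(A)=0$, $\pi(B)=21312+23132+12131+31323$, and let $\pi d(C)\in S_2(4)$ be the 2-cycle obtained by applying the operad map $\pi$ to $$d(C)=A\circ_1 b + A \circ_2 b + A\circ_3 b + b\circ_1 A + b\circ_2 A+B\circ_1 m+B \circ_2 m+B \circ_3 m+m\circ_1 B+m\circ_2 B .$$ Then the homology class of $\pi d(C)$ is $$\alpha(C)=(243)\big((m\circ_2 b)\circ_1 b\big)=[x_1,x_4][x_2,x_3]\in H_2(S(4))\cong H_2(D_2(4),\mathbb{F}_2)\cong(\mathbb{F}_2)^{11}.$$
   Context: The operad $S$ (over $\mathbb{F}_2$). $S_i(k)$ has as basis the sequences of length $i+k$ containing all the integers $1,\dots,k$ (and only these), with no two adjacent entries equal and no ordered (not necessarily contiguous) subsequence of the form $abab$ with $a\ne b$. The differential removes one element of the sequence in all possible ways and sums the results, discarding sequences not satisfying these conditions. An interval decomposition of a sequence $y$ into $n$ subsequences is a covering of $y$ by $n$ ordered non-empty subsequences of consecutive elements $y_1,\dots,y_n$, starting at the first and ending at the last entry of $y$, such that $y_i$ and $y_{i+1}$ share exactly one entry position, the last of $y_i$ and the first of $y_{i+1}$. For $x\in S(p)$, $y\in S(q)$ basis sequences, $x\circ_iy\in S(p+q-1)$ is computed as follows: let $n$ be the number of occurrences of $i$ in $x$; add $q-1$ to every value of $x$ larger than $i$; for each interval decomposition $y_1,\dots,y_n$ of $y$,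 let $y_j'$ be $y_j$ with $i-1$ added to each value, and replace the $j$-th occurrence of $i$ by $y'_j$ for all $j$; sum over all interval decompositions. The symmetric group $\Sigma_k$ acts on $S(k)$ by acting on the values of sequences; $(243)$ denotes the cycle $2\mapsto4\mapsto3\mapsto2$. $S$ is weakly equivalent to the chain operad of the little 2-discs operad $D_2$ (with $D_2(0)=\emptyset$). Its homology $H_*(S)\cong H_*(D_2,\mathbb{F}_2)$ is the Gerstenhaber operad over $\mathbb{F}_2$, with $m=x_1x_2$ (product, degree 0) represented by $12\in S_0(2)$ and $b=[x_1,x_2]$ (bracket, degree 1) represented by $121+212\in S_1(2)$. The symbols $m,b$ (arity 2, dimensions 0, 1), $A,B$ (arity 3, dimensions 1, 2) and $C$ (arity 4, dimension 3) are generators of the bigraded model (a free planar differential graded operad resolving $H_*(D_2,\mathbb{F}_2)$ as a planar operad), with $d(m)=d(b)=0$, $d(A)=m\circ_1m+m\circ_2m$, $d(B)=b\circ_1m+b\circ_2m+m\circ_1b+m\circ_2b$, and $d(C)$ as displayed in the claim. $\pi$ is the map of planar operads with the stated values on $m,b,A,B$; it commutes with differentials. $\alpha(C)$ denotes the homology class of $\pi d(C)$. *)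

(* Defs.v *)
From mathcomp Require Import all_boot all_fingroup all_algebra.

Set Implicit Arguments.
Unset Strict Implicit.
Unset Printing Implicit Defensive.

Import GRing.Theory.
Local Open Scope ring_scope.

(* Sequences in the values 1, ..., k, as lists of natural numbers. *)

Definition is_cactus (k : nat) (s : seq nat) : bool :=
  [&& all (mem (iota 1 k)) s, all (mem s) (iota 1 k),
      sorted (fun a b : nat => a != b) s
    & all2rel (fun a b : nat => (a != b) ==> ~~ subseq [:: a; b; a; b] s) s].

(* The letters live in 'I_k.+1 so that their values are literally 1, ..., k;
   is_cactus excludes the value 0. *)
Definition cactus (i k : nat) : finType :=
  {t : (i + k).-tuple 'I_k.+1 | is_cactus k [seq val v | v <- t]}.

Definition word (i k : nat) (s : cactus i k) : seq nat :=
  [seq nat_of_ord v | v <- val s].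

(* S_i(k): row vectors of coordinates in the basis cactus i k. *)
Definition SOp (i k : nat) := 'rV['F_2]_#|cactus i k|.

Definition coef (i k : nat) (x : SOp i k) (s : cactus i k) : 'F_2 :=
  x 0 (enum_rank s).

(* The sum of a list of sequences, discarding those that are not basis
   elements of S_i(k). *)
Definition formal (i k : nat) (l : seq (seq nat)) : SOp i k :=
  \row_j (count_mem (word (enum_val j)) l)%:R.

Definition removals (s : seq nat) : seq (seq nat) :=
  [seq take j s ++ drop j.+1 s | j <- iota 0 (size s)].

(* For i = 0 this is zero: removing a letter from a sequence of length k leaves
   too few letters, so every term is discarded. *)
Definition dS (i k : nat) (x : SOp i k) : SOp i.-1 k :=
  \sum_(s : cactus i k) coef x s *: formal i.-1 k (removals (word s)).

(* Cutting y at position j puts the entry y_j in both neighbouring intervals;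
   intervals of length one are allowed. *)
Fixpoint interval_decs (n : nat) (y : seq nat) : seq (seq (seq nat)) :=
  match n with
  | 0 => [::]
  | 1 => if nilp y then [::] else [:: [:: y]]
  | n'.+1 => [seq take j.+1 y :: ys | j <- iota 0 (size y),
                                      ys <- interval_decs n' (drop j y)]
  end.

Fixpoint replace_occ (i : nat) (x : seq nat) (ys : seq (seq nat)) : seq nat :=
  match x with
  | [::] => [::]
  | v :: x' => if v == i then head [::] ys ++ replace_occ i x' (behead ys)
               else v :: replace_occ i x' ys
  end.

Definition comp_words (q i : nat) (x y : seq nat) : seq (seq nat) :=
  let x' := [seq if (i < v)%N then (v + (q - 1))%N else v | v <- x] in
  [seq replace_occ i x' [seq [seq (v + (i - 1))%N | v <- yj] | yj <- ys]
     | ys <- interval_decs (count_mem i x) y].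

Definition ocomp (a p b q : nat) (i : nat) (x : SOp a p) (y : SOp b q) :
    SOp (a + b) (p + q - 1) :=
  \sum_(s : cactus a p) \sum_(t : cactus b q)
    (coef x s * coef y t) *:
      formal (a + b) (p + q - 1) (comp_words q i (word s) (word t)).

(* Change of the values of sequences along f; only meant for f permuting
   {1, ..., k}. *)
Definition relabel (i k : nat) (f : nat -> nat) (x : SOp i k) : SOp i k :=
  \sum_(s : cactus i k) coef x s *: formal i k [:: [seq f v | v <- word s]].

(* sigma : 'S_k permutes {0, ..., k-1}; perm_val sigma is the corresponding
   permutation of the values {1, ..., k}. *)
Definition perm_val (k : nat) (sigma : 'S_k) (v : nat) : nat :=
  oapp (fun j : 'I_k => (sigma j).+1) v (insub v.-1).

(* Homology, as the quotient of the group of cycles by the group of boundaries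
   (group multiplication on SOp i k is addition; over the prime field F_2
   subgroups are subspaces and group isomorphisms are linear). *)

Lemma dS_morphM (i k : nat) :
  {in [set: SOp i k] &, {morph @dS i k : x y / (x * y)%g}}.
Proof.
move=> x y _ _; rewrite /dS -[RHS]big_split /=.
by apply: eq_bigr => s _; rewrite /coef mxE scalerDl.
Qed.

Canonical dS_morphism (i k : nat) := Morphism (@dS_morphM i k).

Definition cycles (i k : nat) : {group SOp i k} := 'ker (@dS i k).

Definition boundaries (i k : nat) : {group SOp i k} :=
  (@dS i.+1 k @* [set: SOp i.+1 k])%G.

Definition HS (i k : nat) : {group coset_of (boundaries i k)} :=
  (cycles i k / boundaries i k)%G.

Definition hclass (i k : nat) (x : SOp i k) : coset_of (boundaries i k) :=
  coset (boundaries i k) x.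

(* The operations induced on homology classes by those of S. *)

Definition hcomp (a p b q : nat) (i : nat)
    (x : coset_of (boundaries a p)) (y : coset_of (boundaries b q)) :
    coset_of (boundaries (a + b) (p + q - 1)) :=
  hclass (ocomp i (repr x) (repr y)).

Definition hrelabel (i k : nat) (f : nat -> nat)
    (x : coset_of (boundaries i k)) : coset_of (boundaries i k) :=
  hclass (relabel f (repr x)).

Definition hact (i k : nat) (sigma : 'S_k) (x : coset_of (boundaries i k)) :
    coset_of (boundaries i k) :=
  hrelabel (perm_val sigma) x.

Definition chain_unit : SOp 0 1 := formal 0 1 [:: [:: 1]]%N.
Definition chain_m : SOp 0 2 := formal 0 2 [:: [:: 1; 2]]%N.
Definition chain_b : SOp 1 2 := formal 1 2 [:: [:: 1; 2; 1]; [:: 2; 1; 2]]%N.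

Definition hunit : coset_of (boundaries 0 1) := hclass chain_unit.
Definition hm : coset_of (boundaries 0 2) := hclass chain_m.
Definition hb : coset_of (boundaries 1 2) := hclass chain_b.

(* Elements of the free planar operad on the generators m, b, A, B (the only
   ones occurring in d(C)), written with the operad operations; the indices are
   the dimension and the arity. The terms are not quotiented by the operad
   axioms: pi_map interprets each operation by the one of S, so its value on the
   element denoted by a term is the one computed here. *)

Inductive gen := Gm | Gb | GA | GB.

Definition gdim (g : gen) : nat :=
  match g with Gm => 0 | Gb => 1 | GA => 1 | GB => 2 end.

Definition garity (g : gen) : nat :=
  match g with Gm => 2 | Gb => 2 | GA => 3 | GB => 3 end.

Inductive planar : nat -> nat -> Type :=
| PGen (g : gen) : planar (gdim g) (garity g)
| PId : planar 0 1
| PZero (a p : nat) : planar a p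
| PAdd (a p : nat) : planar a p -> planar a p -> planar a p
| PComp (a p b q : nat) (i : nat) :
    planar a p -> planar b q -> planar (a + b) (p + q - 1).

Definition pi_gen (g : gen) : SOp (gdim g) (garity g) :=
  match g with
  | Gm => chain_m
  | Gb => chain_b
  | GA => 0
  | GB => formal 2 3 [:: [:: 2; 1; 3; 1; 2]; [:: 2; 3; 1; 3; 2];
                         [:: 1; 2; 1; 3; 1]; [:: 3; 1; 3; 2; 3]]%N
  end.

Fixpoint pi_map (a p : nat) (t : planar a p) : SOp a p :=
  match t with
  | PGen g => pi_gen g
  | PId => chain_unit
  | PZero _ _ => 0
  | PAdd _ _ t1 t2 => pi_map t1 + pi_map t2
  | PComp _ _ _ _ i t1 t2 => ocomp i (pi_map t1) (pi_map t2)
  end.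

Definition psum (a p : nat) (ts : seq (planar a p)) : planar a p :=
  foldr (@PAdd a p) (@PZero a p) ts.

Definition dC : planar 2 4 :=
  let m := PGen Gm in let b := PGen Gb in
  let A := PGen GA in let B := PGen GB in
  @psum 2 4
    [:: PComp 1 A b; PComp 2 A b; PComp 3 A b; PComp 1 b A; PComp 2 b A;
        PComp 1 B m; PComp 2 B m; PComp 3 B m; PComp 1 m B; PComp 2 m B].

Definition alphaC : coset_of (boundaries 2 4) := hclass (pi_map dC).

(* The cycle 2 -> 4 -> 3 -> 2; products of permutations act left factor
   first. *)
Definition cycle243 : 'S_4 :=
  (tperm (inord 1) (inord 3) * tperm (inord 1) (inord 2))%g.

Lemma cycle243E :
  [seq perm_val cycle243 v | v <- [:: 1; 2; 3; 4]%N] = [:: 1; 4; 2; 3]%N.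
Proof.
have o (n : nat) (lt_n4 : (n < 4)%N) : insub n = Some (inord n : 'I_4).
  by rewrite insubT; congr Some; apply: val_inj; rewrite /= inordK.
rewrite /= /perm_val !o //= !permM.
by rewrite !permE /= -!val_eqE /= !inordK //= !permE /= -!val_eqE /= !inordK.
Qed.

(* Gerstenhaber monomials in the variables x_1, x_2, ..., and the homology class
   of S denoted by a monomial in which each of x_1, ..., x_k occurs once: the
   planar composite of m and b of the shape of the monomial has inputs numbered
   from left to right, and input v is then renamed to the v-th variable. *)

Inductive gerst :=
| GVar of nat
| GMul of gerst & gerst
| GBr of gerst & gerst.

Fixpoint gvars (t : gerst) : seq nat :=
  match t with
  | GVar n => [:: n]
  | GMul t1 t2 | GBr t1 t2 => gvars t1 ++ gvars t2
  end.

Fixpoint gerst_dim (t : gerst) : nat :=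
  match t with
  | GVar _ => 0
  | GMul t1 t2 => 0 + gerst_dim t2 + gerst_dim t1
  | GBr t1 t2 => 1 + gerst_dim t2 + gerst_dim t1
  end.

(* This is size (gvars t), in the form given by the type of hcomp. *)
Fixpoint gerst_arity (t : gerst) : nat :=
  match t with
  | GVar _ => 1
  | GMul t1 t2 | GBr t1 t2 =>
      2 + gerst_arity t2 - 1 + gerst_arity t1 - 1
  end.

Fixpoint gerst_planar (t : gerst) :
    coset_of (boundaries (gerst_dim t) (gerst_arity t)) :=
  match t with
  | GVar _ => hunit
  | GMul t1 t2 => hcomp 1 (hcomp 2 hm (gerst_planar t2)) (gerst_planar t1)
  | GBr t1 t2 => hcomp 1 (hcomp 2 hb (gerst_planar t2)) (gerst_planar t1)
  end.

Definition gerst_class (t : gerst) :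
    coset_of (boundaries (gerst_dim t) (gerst_arity t)) :=
  hrelabel (fun v => nth 0%N (gvars t) v.-1) (gerst_planar t).

(* Main.v *)
From HB Require Import structures.
Require Import Defs.
From mathcomp Require Import all_boot all_fingroup all_algebra.

(** Why the theorem holds.

The homology of S(4) is computed with a discrete Morse matching, built by adding
the letters one at a time. Deleting the letter k from a word of S(k), and
merging equal neighbours, gives a word of S(k-1); the words over a given word w
describe the positions of the lobe k around the cactus w, so they form a complex
with the homology of a plane with k-1 holes. The matching ([up]) collapses it to
k critical words, one of degree 0 and k-1 of degree 1, and then matches these
critical words as their images w are matched in S(k-1). Hence the critical words
([critical_words]) are counted by the coefficients of (1+t)(1+2t)(1+3t), which
gives 11 in degree 2 of S(4). Gradient paths do not cycle, and following them
completes every critical word to a cycle ([cycle_of]), so no further cancellation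
takes place: the classes of these cycles are a basis of the homology
([morse_homology], [H2_S4]). The hypotheses on the matching are statements about
finitely many words and are decided by computation.

The formula for the class of pi d(C) needs one chain of degree 3 whose boundary is
pi d(C) plus the chain of [x_1,x_4][x_2,x_3]. The gradient flow finds it
([filling]): a null-homologous cycle is the boundary of its own flow.

The operations on homology classes are computed on representatives that are
determined only up to boundaries. Relabelling is a chain map ([dS_relabel]). For
composition, b and the unit have no other representative, since S(2) is zero in
degree 2 and S(1) in degree 1; composing with them on the right sends boundaries
to boundaries ([ocomp_boundary]), by the Leibniz rule on the basis.

Every chain is handled as a list of words counted modulo 2 ([formal]), which turns
equalities of chains into parity checks ([eq_formal]). *)

Set Implicit Arguments.
Unset Strict Implicit.
Unset Printing Implicit Defensive.

Import GRing.Theory.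
Local Open Scope ring_scope.

(** * Chains as lists of words *)

Definition valid (i k : nat) (s : seq nat) : bool :=
  (size s == i + k)%N && is_cactus k s.

Lemma word_valid i k (t : cactus i k) : valid i k (word t).
Proof. by rewrite /valid size_map size_tuple eqxx /= (valP t). Qed.

Lemma word_inj i k : injective (@word i k).
Proof. by move=> s t /(inj_map val_inj)/val_inj/val_inj. Qed.

Lemma valid_word i k s : valid i k s -> {t : cactus i k | word t = s}.
Proof.
case/andP=> /eqP size_s cact_s.
have lt_s : all (fun v => v < k.+1)%N s.
  case/and4P: cact_s => /allP s_le _ _ _.
  by apply/allP=> v /s_le; rewrite inE mem_iota add1n => /andP[].
have val_s : [seq val v | v <- [seq inord v : 'I_k.+1 | v <- s]] = s.
  by rewrite -map_comp; apply: map_id_in => v /(allP lt_s) /= /inordK.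
have size_t : size [seq inord v : 'I_k.+1 | v <- s] == (i + k)%N.
  by rewrite size_map size_s.
have cact_t : is_cactus k [seq val v | v <- Tuple size_t] by rewrite val_s.
by exists (exist _ (Tuple size_t) cact_t).
Qed.

Lemma coef_formal i k l (t : cactus i k) :
  coef (formal i k l) t = (count_mem (word t) l)%:R.
Proof. by rewrite /coef mxE enum_rankK. Qed.

Lemma coef_inj i k (x y : SOp i k) :
  (forall t, coef x t = coef y t) -> x = y.
Proof.
by move=> eq_xy; apply/rowP=> j; have := eq_xy (enum_val j);
  rewrite /coef enum_valK.
Qed.

Lemma coef_zero i k (t : cactus i k) : coef 0 t = 0.
Proof. exact: mxE. Qed.

Lemma coef_add i k (x y : SOp i k) t : coef (x + y) t = coef x t + coef y t.
Proof. exact: mxE. Qed.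

Lemma coef_scale i k a (x : SOp i k) t : coef (a *: x) t = a * coef x t.
Proof. exact: mxE. Qed.

Lemma coef_bigsum i k I (r : seq I) (P : pred I) (F : I -> SOp i k) t :
  coef (\sum_(j <- r | P j) F j) t = \sum_(j <- r | P j) coef (F j) t.
Proof. exact: summxE. Qed.

Lemma two_F2 : 2%:R = 0 :> 'F_2.
Proof. exact: val_inj. Qed.

Lemma natr_F2 n : n%:R = (odd n)%:R :> 'F_2.
Proof.
by rewrite -[in LHS](odd_double_half n) natrD -mul2n natrM two_F2 mul0r addr0.
Qed.

Definition same_parity (l1 l2 : seq (seq nat)) : bool :=
  all (fun s => odd (count_mem s l1) == odd (count_mem s l2)) (l1 ++ l2).

Lemma eq_formal i k l1 l2 : same_parity l1 l2 -> formal i k l1 = formal i k l2.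
Proof.
move=> /allP eq_l; apply: coef_inj => t; rewrite !coef_formal natr_F2 [RHS]natr_F2.
have [/eq_l/eqP-> // |] := boolP (word t \in l1 ++ l2).
by rewrite mem_cat negb_or -!has_pred1 !has_count -!eqn0Ngt => /andP[/eqP-> /eqP->].
Qed.

Lemma formal_nil i k : formal i k [::] = 0.
Proof. by apply: coef_inj => t; rewrite coef_formal coef_zero. Qed.

Lemma formal_cat i k l1 l2 : formal i k (l1 ++ l2) = formal i k l1 + formal i k l2.
Proof.
by apply: coef_inj => t; rewrite coef_add !coef_formal count_cat natrD.
Qed.

Lemma formal_flatten i k ll :
  formal i k (flatten ll) = \sum_(l <- ll) formal i k l.
Proof.
elim: ll => [|l ll IHll]; first by rewrite big_nil formal_nil.
by rewrite big_cons /= formal_cat IHll.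
Qed.

Lemma coef_basis i k l (t : cactus i k) :
  coef (formal i k [:: l]) t = (word t == l)%:R.
Proof. by rewrite coef_formal /= addn0 eq_sym. Qed.

Lemma chain_sum i k (x : SOp i k) :
  x = \sum_t coef x t *: formal i k [:: word t].
Proof.
apply: coef_inj => t; rewrite coef_bigsum (bigD1 t) //= big1 => [|s s't].
  by rewrite coef_scale coef_basis eqxx mulr1 addr0.
by rewrite coef_scale coef_basis (inj_eq (@word_inj _ _)) eq_sym (negPf s't) mulr0.
Qed.

(** The differential and the relabellings are linear extensions of functions on
words, and composition is one in each argument, so they share the lemmas below. *)
Definition lin i k (V : lmodType 'F_2) (phi : seq nat -> V) (x : SOp i k) : V :=
  \sum_s coef x s *: phi (word s).

Section Lin.
Variables (i k : nat) (V : lmodType 'F_2).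
Implicit Types (phi : seq nat -> V) (x : SOp i k).

Lemma lin_is_linear phi : linear (@lin i k V phi).
Proof.
move=> a x y; rewrite /lin scaler_sumr -big_split; apply: eq_bigr => s _ /=.
by rewrite coef_add coef_scale scalerDl scalerA.
Qed.

HB.instance Definition _ phi :=
  GRing.isLinear.Build 'F_2 (SOp i k) V *:%R (lin phi) (lin_is_linear phi).

Lemma lin_formal phi l :
  lin phi (formal i k l) = \sum_(s <- l | valid i k s) phi s.
Proof.
elim: l => [|s l IHl]; first by rewrite formal_nil linear0 big_nil.
have -> : lin phi (formal i k (s :: l)) =
    lin phi (formal i k [:: s]) + lin phi (formal i k l).
  by rewrite -linearD -formal_cat.
rewrite IHl big_cons {1}/lin.
have [val_s|inv_s] := ifP.
  have [t word_t] := valid_word val_s; rewrite (bigD1 t) //= big1 => [|t' t't].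
    by rewrite coef_basis word_t eqxx scale1r addr0.
  by rewrite coef_basis -word_t (inj_eq (@word_inj _ _)) (negPf t't) scale0r.
rewrite big1 ?add0r // => t _; rewrite coef_basis.
by have [eq_ts|_] := eqVneq; [rewrite -eq_ts word_valid in inv_s | exact: scale0r].
Qed.

Lemma lin_comp (W : lmodType 'F_2) (f : {linear V -> W}) phi x :
  f (lin phi x) = lin (f \o phi) x.
Proof. by rewrite linear_sum; apply: eq_bigr => s _; rewrite linearZ. Qed.

Lemma eq_lin phi psi x :
  (forall s, valid i k s -> phi s = psi s) -> lin phi x = lin psi x.
Proof. by move=> eq_phi; apply: eq_bigr => s _; rewrite eq_phi // word_valid. Qed.

Lemma coef_lin i' k' (F : seq nat -> seq (seq nat)) x (t : cactus i' k') :
  coef (lin (fun s => formal i' k' (F s)) x) t =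
  \sum_s coef x s * (count_mem (word t) (F (word s)))%:R.
Proof.
by rewrite coef_bigsum; apply: eq_bigr => s _; rewrite coef_scale coef_formal.
Qed.

End Lin.

Lemma formal_lin i k i' k' (F : seq nat -> seq (seq nat)) l :
  lin (fun s => formal i' k' (F s)) (formal i k l) =
  formal i' k' (flatten [seq F s | s <- l & valid i k s]).
Proof. by rewrite lin_formal formal_flatten big_map big_filter. Qed.

Lemma dS_is_linear i k : linear (@dS i k).
Proof. exact: (lin_is_linear (fun s => formal i.-1 k (removals s))). Qed.

HB.instance Definition _ i k :=
  GRing.isLinear.Build 'F_2 (SOp i k) (SOp i.-1 k) *:%R (@dS i k)
    (@dS_is_linear i k).

(** A face of a cactus contains no abab, so it can only fail to be a cactus by
repeating a letter or by missing one. Testing just this keeps boundaries short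
at little cost. *)
Definition spread (k : nat) (s : seq nat) : bool :=
  sorted (fun a b => a != b) s && all (mem s) (iota 1 k).

Definition bdry (k : nat) (l : seq (seq nat)) : seq (seq nat) :=
  flatten [seq [seq r <- removals s | spread k r] | s <- l].

Lemma formal_spread i k l :
  formal i k [seq r <- l | spread k r] = formal i k l.
Proof.
apply: coef_inj => t; rewrite !coef_formal count_filter; congr _%:R.
apply: eq_count => s /=; have [->|//] := eqVneq s; rewrite /spread.
by have /andP[_ /and4P[_ -> -> _]] := word_valid t.
Qed.

Lemma dS_formal i k l : all (valid i k) l ->
  dS (formal i k l) = formal i.-1 k (bdry k l).
Proof.
move=> /all_filterP val_l; rewrite [LHS]formal_lin val_l !formal_flatten !big_map.
by apply: eq_bigr => s _; rewrite formal_spread.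
Qed.

Fixpoint walks (k n : nat) : seq (seq nat) :=
  if n is n'.+1 then
    [seq a :: s | a <- iota 1 k, s <- [seq s <- walks k n' | head 0 s != a]]
  else [:: [::]].

Definition words (i k : nat) : seq (seq nat) :=
  [seq s <- walks k (i + k) | valid i k s].

Lemma mem_walks k s :
  all (mem (iota 1 k)) s -> sorted (fun a b => a != b) s -> s \in walks k (size s).
Proof.
elim: s => //= a s IHs /andP[k_a k_s] path_s.
apply/allpairsPdep; exists a, s.
rewrite mem_filter IHs ?(path_sorted path_s) // andbT; split=> //.
case: s path_s {IHs k_s} => /= [_|b s /andP[]].
  (* The default 0 of head is not a letter. *)
  by have: a \in iota 1 k; [exact: k_a | rewrite mem_iota; case: (a)].
by rewrite eq_sym.
Qed.

Lemma mem_words i k s : (s \in words i k) = valid i k s.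
Proof.
rewrite mem_filter; case val_s: (valid i k s) => //=.
by have /andP[/eqP <- /and4P[? _ ? _]] := val_s; apply: mem_walks.
Qed.

(** * The differential squares to zero *)

Notation reduced := (sorted (fun a b : nat => a != b)).

Lemma removals_cons a s : removals (a :: s) = s :: [seq a :: r | r <- removals s].
Proof.
by rewrite /removals /= drop0 (iotaDl 1 0) -!map_comp.
Qed.

Lemma removals_subseq r s : r \in removals s -> subseq r s /\ size s = (size r).+1.
Proof.
elim: s r => [|a s IHs] r //; rewrite removals_cons inE => /orP[/eqP->|].
  by split=> //; apply: subseq_cons.
by case/mapP=> r' /IHs[sub_r' /= ->] ->; rewrite /= eqxx.
Qed.

Lemma count_map_cons (a : nat) t l :
  count_mem t [seq a :: r | r <- l] =
  if t is b :: t' then (if a == b then count_mem t' l else 0)%N else 0%N.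
Proof.
elim: l => [|r l IHl] /=; first by case: t => // b t; case: eqP.
rewrite IHl; case: t {IHl} => //= b t; rewrite eqseq_cons.
by case: eqP.
Qed.

(** Removing two letters in either order gives the same word. *)
Lemma removals2_even s t :
  ~~ odd (count_mem t (flatten [seq removals r | r <- removals s])).
Proof.
elim: s t => // a s IHs t; rewrite removals_cons /=.
rewrite -map_comp (eq_map (removals_cons a)).
have count_cons l :
    count_mem t (flatten [seq r :: [seq a :: r' | r' <- removals r] | r <- l]) =
    (count_mem t l +
     count_mem t [seq a :: r | r <- flatten [seq removals r | r <- l]])%N.
  elim: l => //= r l IHl.
  rewrite map_cat !count_cat IHl -[in RHS]addnA; congr addn.
  exact: addnCA.
rewrite count_cat count_cons addnA addnn oddD odd_double /= count_map_cons.
by case: t {count_cons} => // b t; case: ifP.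
Qed.

(** Only the removal of one of two equal neighbours can make the word reduced, and
both removals give the same word. *)
Lemma removals_unreduced r t : ~~ reduced r -> reduced t ->
  ~~ odd (count_mem t (removals r)).
Proof.
elim: r t => // a r IHr t; rewrite removals_cons /=.
have [red_r | unred_r] := boolP (reduced r).
  case: r red_r {IHr} => // b r red_r.
  rewrite [path _ _ _]/= [path _ b r]red_r andbT negbK => /eqP<- red_t.
  rewrite removals_cons /= addnA addnn oddD odd_double -map_comp /=.
  rewrite (_ : count _ _ = 0%N) //; apply/count_memPn/mapP=> -[r' _ def_t].
  by rewrite def_t /= eqxx in red_t.
move=> _ red_t; have [eq_rt | _] := eqVneq r t; first by rewrite eq_rt red_t in unred_r.
rewrite add0n count_map_cons; case: t red_t => //= b t /path_sorted red_t.
by case: ifP => // _; apply: IHr.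
Qed.

Lemma is_cactus_subseq k s r : is_cactus k s -> subseq r s ->
  reduced r -> all (mem r) (iota 1 k) -> is_cactus k r.
Proof.
case/and4P=> k_s _ _ no_abab sub_rs red_r k_r; have mem_r := mem_subseq sub_rs.
apply/and4P; split=> //; first by apply/allP=> a /mem_r/(allP k_s).
apply/allrelP=> a b /mem_r s_a /mem_r s_b.
apply/implyP=> neq_ab; have /allrelP/(_ a b s_a s_b) := no_abab.
by rewrite neq_ab; apply: contra => /subseq_trans->.
Qed.

(** The faces that the differential discards would contribute nothing to its
square, so that [removals2_even] applies as if no face were discarded. *)
Lemma removals_invalid i k s r t :
  valid i.+1 k s -> r \in removals s -> ~~ valid i k r -> reduced t ->
  all (mem t) (iota 1 k) -> ~~ odd (count_mem t (removals r)).
Proof.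
case/andP=> /eqP size_s cact_s /removals_subseq[sub_rs size_r] inv_r red_t k_t.
have [red_r | /removals_unreduced-> //] := boolP (reduced r).
rewrite (count_memPn _) //.
apply: contra inv_r => /removals_subseq[/mem_subseq sub_tr _].
apply/andP; split; first by rewrite -eqSS -size_r size_s.
apply: is_cactus_subseq cact_s sub_rs red_r _.
by apply: sub_all k_t => a /sub_tr.
Qed.

Lemma dS_dS i k (x : SOp i.+2 k) : dS (dS x) = 0.
Proof.
rewrite {2}/dS linear_sum big1 // => s _; rewrite linearZ /= [dS _](formal_lin).
rewrite (_ : formal i k _ = 0) ?scaler0 //; apply: coef_inj => t.
rewrite coef_formal coef_zero natr_F2.
have /andP[_ /and4P[_ k_t red_t _]] := word_valid t.
have odd_valid l : {subset l <= removals (word s)} ->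
    odd (count_mem (word t) (flatten [seq removals r | r <- l & valid i.+1 k r])) =
    odd (count_mem (word t) (flatten [seq removals r | r <- l])).
  elim: l => //= r l IHl sub_l; have s_r := sub_l r (mem_head _ _).
  have {}IHl := IHl (fun r' l_r' => sub_l r' (@mem_behead _ (r :: l) r' l_r')).
  rewrite [in RHS]count_cat oddD -IHl; case: ifP => [_ | /negbT inv_r] /=.
    by rewrite count_cat oddD.
  by rewrite (negPf (removals_invalid (word_valid s) s_r inv_r red_t k_t)).
by rewrite odd_valid // (negPf (removals2_even _ _)).
Qed.

(** * Discrete Morse theory *)

(** [V] matches some basis words with words of one degree more; [V s = Some y]
means that s is the lower end of the match (s, y). *)

Section Morse.

Variables (k : nat) (V : seq nat -> option (seq nat)).

Definition partner (s : seq nat) : seq (seq nat) := oapp (cons^~ [::]) [::] (V s).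

Definition matched (i : nat) : bool :=
  all (fun s => all (fun y => valid i.+1 k y && odd (count_mem s (removals y)))
                    (partner s)) (words i k).

(** Edges of the gradient paths from s through its partner to another lower end. *)
Definition gradient_edges (i : nat) : seq (seq nat * seq nat) :=
  [seq (s, t) | s <- words i k,
                t <- [seq t <- bdry k (partner s) | (t != s) && V t]].

Definition targets (E : seq (seq nat * seq nat)) (F : seq (seq nat)) :=
  undup [seq e.2 | e <- E & e.1 \in F].

(** Gradient paths are finite: no lower end is reached by a path with as many
edges as there are lower ends. *)
Definition acyclic (i : nat) : bool :=
  let F := [seq s <- words i k | V s] in
  iter (size F) (targets (gradient_edges i)) F == [::].

Definition gradient (i : nat) (x : SOp i k) : SOp i.+1 k :=
  lin (fun s => formal i.+1 k (partner s)) x.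

Lemma gradient_is_linear i : linear (@gradient i).
Proof. exact: lin_is_linear. Qed.

HB.instance Definition _ i :=
  GRing.isLinear.Build 'F_2 (SOp i k) (SOp i.+1 k) *:%R (@gradient i)
    (@gradient_is_linear i).

(** The normal form modulo boundaries: no lower end of a match occurs. *)
Definition settled (i : nat) (x : SOp i k) : Prop :=
  forall t, V (word t) -> coef x t = 0.

Lemma settledD i (x y : SOp i k) : settled x -> settled y -> settled (x + y).
Proof. by move=> fx fy t Vt; rewrite coef_add fx ?fy ?addr0. Qed.

Lemma gradient_eq0 i (x : SOp i k) : settled x -> gradient x = 0.
Proof.
move=> settled_x; apply: big1 => s _; rewrite /partner.
case Vs: (V (word s)) => [y|] /=; last by rewrite formal_nil scaler0.
by rewrite settled_x ?scale0r // Vs.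
Qed.

Section Degree.
Variable i : nat.
Hypotheses (match_i : matched i) (acyclic_i : acyclic i).
Implicit Types (s t : cactus i k) (x : SOp i k).

Definition incidence s t : 'F_2 :=
  (count_mem (word t) (flatten [seq removals y | y <- partner (word s)]))%:R.

Lemma dS_gradient x t :
  coef (dS (gradient x)) t = \sum_s coef x s * incidence s t.
Proof.
rewrite /gradient lin_comp.
rewrite -(coef_lin (fun w => flatten [seq removals y | y <- partner w])).
congr (coef _ t); apply: eq_lin => w val_w /=; rewrite [LHS]formal_lin.
suffices /all_filterP-> : all (valid i.+1 k) (partner w) by [].
have /(allP match_i) all_w : w \in words i k by rewrite mem_words.
by apply: sub_all all_w => y /andP[].
Qed.

Lemma incidence_diag s : V (word s) -> incidence s s = 1.
Proof.
move=> Vs; have /(allP match_i) : word s \in words i k by rewrite mem_words word_valid.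
rewrite /incidence /partner; case: (V _) Vs => //= y _.
by rewrite cats0 andbT => /andP[_ odd_s]; rewrite natr_F2 odd_s.
Qed.

Lemma incidence_edge s t :
  incidence s t != 0 -> t != s -> V (word t) ->
  V (word s) /\ (word s, word t) \in gradient_edges i.
Proof.
move=> inc_st neq_ts Vt; split.
  move: inc_st; rewrite /incidence /partner.
  by case: (V (word s)); rewrite //= mulr0n eqxx.
apply/allpairsPdep; exists (word s), (word t).
rewrite mem_words word_valid mem_filter Vt (inj_eq (@word_inj _ _)) neq_ts.
split=> //; rewrite /bdry /=; have /andP[_ /and4P[_ k_t srt_t _]] := word_valid t.
move: inc_st; rewrite /incidence; elim: (partner _) => //= y l IHl.
rewrite count_cat natrD mem_cat mem_filter /spread srt_t k_t /=.
have [//|t'y] := boolP (word t \in removals y).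
by rewrite (count_memPn t'y) add0r; apply: IHl.
Qed.

Definition within (F : seq (seq nat)) x : Prop :=
  forall t, V (word t) -> coef x t != 0 -> word t \in F.

Lemma within_matched x : within [seq s <- words i k | V s] x.
Proof. by move=> t Vt _; rewrite mem_filter Vt mem_words word_valid. Qed.

Lemma within_nil x : within [::] x -> settled x.
Proof. by move=> no_x t Vt; apply/eqP/negPn/negP=> /(no_x t Vt). Qed.

(** On the lower ends, the boundary of the gradient is the identity plus terms along
gradient edges; modulo 2 the identity cancels against x. *)
Lemma within_targets F x t :
  within F x -> V (word t) -> coef (x + dS (gradient x)) t != 0 ->
  word t \in targets (gradient_edges i) F.
Proof.
move=> F_x Vt; rewrite coef_add dS_gradient (bigD1 t) //= incidence_diag // mulr1.
rewrite addrA -mulr2n -mulr_natl two_F2 mul0r add0r => sum_neq0.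
have [s /andP[neq_st]] : exists s, (s != t) && (coef x s * incidence s t != 0).
  apply/existsP; apply: contraNT sum_neq0 => /existsPn no_s.
  apply/eqP/big1 => s neq_st.
  by have := no_s s; rewrite neq_st negbK => /eqP.
rewrite mulf_eq0 negb_or => /andP[x_s inc_st].
have [||Vs edge_st] := incidence_edge inc_st; rewrite 1?eq_sym //.
rewrite mem_undup; apply/mapP; exists (word s, word t) => //.
by rewrite mem_filter /= F_x.
Qed.

(** Each addition of the boundary of the gradient moves the lower ends that occur
one edge further along gradient paths, and these are finite. *)
Lemma push_settled x : exists y : SOp i.+1 k, settled (x + dS y).
Proof.
have := within_matched (x := x); move/eqP: acyclic_i; set F := filter _ _.
move: F (size F) => F n; elim: n F x => [|n IHn] F x F0 F_x.
  move: F0 => /= F0; exists 0; rewrite linear0 addr0; apply: within_nil.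
  by rewrite -F0.
have [|y settled_y] := IHn _ (x + dS (gradient x)) (etrans (esym (iterSr _ _ _)) F0).
  by move=> t Vt; apply: within_targets.
by exists (gradient x + y); rewrite linearD addrA.
Qed.

(** The boundary of the gradient is unitriangular on the lower ends: a lower end
with nonzero coefficient in x would be reached from another one, and so on along
an infinite gradient path. *)
Lemma gradient_inj x : settled (dS (gradient x)) -> gradient x = 0.
Proof.
move=> settled_dx; apply: gradient_eq0; apply: within_nil.
have := within_matched (x := x); move/eqP: acyclic_i; set F := filter _ _.
move: F (size F) => F n; elim: n F => [|n IHn] F F0 F_x; first by rewrite -F0.
apply: IHn (etrans (esym (iterSr _ _ _)) F0) _ => t Vt x_t.
by apply: (within_targets F_x) => //; rewrite coef_add settled_dx ?addr0.
Qed.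

End Degree.

Variables (crit : nat -> seq (seq nat)) (cyc : seq nat -> seq (seq nat)).

(** The list [cyc c] completes the critical word c to a settled cycle that contains
no other critical word; its existence means that the differential of the Morse
complex vanishes. *)
Definition critical_cycles (i : nat) : bool :=
  uniq (crit i) &&
  all (fun c => let z := cyc c in
         [&& all (valid i k) z, same_parity (bdry k z) [::], all (fun s => ~~ V s) z
           & all (fun c' => odd (count_mem c' z) == (c' == c)) (crit i)])
      (crit i).

Definition covered (i : nat) : bool :=
  let M := flatten [seq partner s | s <- words i k] in
  all (fun t => [|| isSome (V t), t \in crit i.+1 | t \in M]) (words i.+1 k).

Definition cycle_sum (i : nat) (v : 'rV['F_2]_(size (crit i))) : SOp i k :=
  \sum_j v 0 j *: formal i k (cyc (nth [::] (crit i) j)).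

Lemma cycle_sum_is_linear i : linear (@cycle_sum i).
Proof.
move=> a u v; rewrite /cycle_sum scaler_sumr -big_split; apply: eq_bigr => j _ /=.
by rewrite !mxE scalerDl scalerA.
Qed.

HB.instance Definition _ i :=
  GRing.isLinear.Build 'F_2 'rV['F_2]_(size (crit i)) (SOp i k) *:%R (@cycle_sum i)
    (@cycle_sum_is_linear i).

Section Cycles.
Variable i : nat.
Hypothesis cycles_i : critical_cycles i.
Let n := size (crit i).
Implicit Types (j : 'I_n) (v : 'rV['F_2]_n).

Let cell j := nth [::] (crit i) j.

Let cell_crit j : cell j \in crit i.
Proof. exact: mem_nth. Qed.

Let cell_inj : injective cell.
Proof.
have /andP[uniq_crit _] := cycles_i.
by move=> j j' /eqP; rewrite nth_uniq // => /eqP/val_inj.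
Qed.

Let cycP j : [/\ all (valid i k) (cyc (cell j)),
                 same_parity (bdry k (cyc (cell j))) [::],
                 all (fun s => ~~ V s) (cyc (cell j))
               & forall j', odd (count_mem (cell j') (cyc (cell j))) = (j' == j)].
Proof.
have /andP[_ /allP all_cyc] := cycles_i.
have /and4P[valid_j cycle_j settled_j /allP odd_j] := all_cyc _ (cell_crit j).
by split=> // j'; rewrite (eqP (odd_j _ (cell_crit j'))) (inj_eq cell_inj).
Qed.

Lemma critical_word j : {t : cactus i k | word t = nth [::] (crit i) j}.
Proof.
have [/allP valid_j _ _ /(_ j)] := cycP j; rewrite eqxx => odd_j.
apply: valid_word; apply: valid_j; rewrite -has_pred1 has_count.
by case: (count _ _) odd_j.
Qed.

Lemma dS_cycle_sum v : dS (cycle_sum v) = 0.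
Proof.
rewrite linear_sum big1 // => j _; rewrite linearZ /=.
have [valid_j cycle_j _ _] := cycP j.
by rewrite (dS_formal valid_j) (eq_formal _ _ cycle_j) formal_nil scaler0.
Qed.

Lemma settled_cycle_sum v : settled (cycle_sum v).
Proof.
move=> t Vt; rewrite coef_bigsum big1 // => j _; rewrite coef_scale coef_formal.
have [_ _ /allP settled_j _] := cycP j.
rewrite (count_memPn _) ?mulr0 //.
by apply: contraL Vt => /settled_j.
Qed.

Lemma coef_cycle_sum v j : coef (cycle_sum v) (sval (critical_word j)) = v 0 j.
Proof.
have coef_j j' : coef (formal i k (cyc (cell j'))) (sval (critical_word j)) =
    (j == j')%:R.
  have [_ _ _ odd_j'] := cycP j'; case: critical_word => t /= word_t.
  by rewrite coef_formal natr_F2 word_t odd_j'.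
rewrite coef_bigsum (bigD1 j) //= big1 => [|j' neq_j]; rewrite coef_scale coef_j.
  by rewrite eqxx mulr1 addr0.
by rewrite eq_sym (negPf neq_j) mulr0.
Qed.

End Cycles.

(** A settled chain consists of critical words, which are removed by subtracting the
cycles that complete them, and of upper ends of matches, which are gradients. *)
Lemma normal_form i (x : SOp i.+1 k) :
  matched i -> covered i -> critical_cycles i.+1 -> matched i.+1 -> acyclic i.+1 ->
  exists (a : SOp i k) v (y : SOp i.+2 k), x + dS y = gradient a + cycle_sum v.
Proof.
move=> match_i cov_i cyc_i match_i1 acyc_i1.
have [y settled_y] := push_settled match_i1 acyc_i1 x; set x1 := x + _ in settled_y.
pose v : 'rV['F_2]_(size (crit i.+1)) :=
  \row_j coef x1 (sval (critical_word cyc_i j)).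
pose x2 := x1 - cycle_sum v.
have settled_x2 : settled x2.
  apply: settledD => // t Vt; rewrite -scaleN1r coef_scale.
  by rewrite (settled_cycle_sum cyc_i) ?mulr0.
have crit_x2 t : word t \in crit i.+1 -> coef x2 t = 0.
  move=> crit_t; have lt_t := crit_t; rewrite -index_mem in lt_t.
  have -> : t = sval (critical_word cyc_i (Ordinal lt_t)).
    by apply: word_inj; case: critical_word => /= t' ->; rewrite nth_index.
  by rewrite coef_add -scaleN1r coef_scale coef_cycle_sum mxE mulN1r subrr.
(* The lower end of the match with upper end t. *)
pose source t := nth [::] (words i k) (find (fun s => V s == Some t) (words i k)).
exists (\sum_t coef x2 t *: formal i k [:: source (word t)]), v, y.
rewrite -[x + _](subrK (cycle_sum v)) -/x2; congr (_ + _).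
rewrite linear_sum [LHS]chain_sum; apply: eq_bigr => t _; rewrite linearZ /=.
have [->|x2_t] := eqVneq (coef x2 t) 0; first by rewrite !scale0r.
congr (_ *: _); have words_t : word t \in words i.+1 k by rewrite mem_words word_valid.
have /or3P[Vt | crit_t | ] := allP cov_i _ words_t.
- by rewrite settled_x2 ?eqxx in x2_t.
- by rewrite crit_x2 ?eqxx in x2_t.
case/flatten_mapP=> s words_s partner_t.
have has_t : has (fun s => V s == Some (word t)) (words i k).
  apply/hasP; exists s => //; move: partner_t; rewrite /partner.
  by case: (V s) => //= y'; rewrite inE => /eqP->.
have /eqP V_source := nth_find [::] has_t.
rewrite /gradient lin_formal big_mkcond big_seq1 -mem_words mem_nth -?has_find //.
by rewrite /partner V_source.
Qed.

End Morse.

(** * Homology classes *)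

Lemma cyclesP i k (x : SOp i k) : reflect (dS x = 0) (x \in cycles i k).
Proof. by apply: (iffP idP) => [/mker|dx]; last apply/kerP; rewrite ?inE. Qed.

Lemma boundariesP i k (x : SOp i k) :
  reflect (exists y : SOp i.+1 k, dS y = x) (x \in boundaries i k).
Proof.
apply: (iffP idP) => [/morphimP[y _ _ ->] | [y <-]]; first by exists y.
by apply: (@mem_morphim _ _ _ (dS_morphism i.+1 k)); rewrite inE.
Qed.

Lemma boundaries_norm i k (x : SOp i k) : x \in 'N(boundaries i k)%g.
Proof.
have abel : abelian [set: SOp i k] by exact: FinRing.zmod_abelian.
have /subsetP := sub_abelian_norm abel (subsetT (boundaries i k)).
by apply; rewrite inE.
Qed.

Lemma hclass_eq i k (x y : SOp i k) :
  hclass x = hclass y <-> exists z : SOp i.+1 k, dS z = x - y.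
Proof.
have norm_x := boundaries_norm x; have norm_y := boundaries_norm y.
split=> [/(rcoset_kercosetP norm_x norm_y) | bound_xy].
  by rewrite mem_rcoset => /boundariesP.
by apply/(rcoset_kercosetP norm_x norm_y); rewrite mem_rcoset; apply/boundariesP.
Qed.

Lemma repr_hclass i k (x : SOp i k) :
  exists y : SOp i.+1 k, repr (hclass x) = x + dS y.
Proof.
have [y dy] : exists y : SOp i.+1 k, dS y = repr (hclass x) - x.
  by apply/hclass_eq; apply: coset_reprK.
by exists y; rewrite dy addrC subrK.
Qed.

Section Homology.

Variables (k : nat) (V : seq nat -> option (seq nat)).
Variables (crit : nat -> seq (seq nat)) (cyc : seq nat -> seq (seq nat)).

Definition perfect (i : nat) : bool :=
  [&& matched k V i, acyclic k V i, covered k V crit i &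
      critical_cycles k V crit cyc i.+1].

Variable i : nat.
Hypotheses (perfect_i : perfect i) (perfect_i1 : perfect i.+1).
Hypotheses (match_i2 : matched k V i.+2) (acyc_i2 : acyclic k V i.+2).

Definition cycle_class (v : 'rV['F_2]_(size (crit i.+1))) :
    coset_of (boundaries i.+1 k) :=
  hclass (cycle_sum k cyc v).

Lemma cycle_class_morphM :
  {in [set: 'rV_(size (crit i.+1))] &, {morph cycle_class : u v / (u * v)%g}}.
Proof.
move=> u v _ _; rewrite /cycle_class.
have -> : cycle_sum k cyc (u * v)%g = (cycle_sum k cyc u * cycle_sum k cyc v)%g.
  exact: linearD.
by apply: morphM; apply: boundaries_norm.
Qed.

Canonical cycle_class_morphism := Morphism cycle_class_morphM.

(** In normal form, a chain bounded by a combination of critical cycles is a gradient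
up to cycles. As the combination is settled, the gradient vanishes. *)
Lemma cycle_class_inj : ('injm cycle_class)%g.
Proof.
have /and4P[_ _ _ cyc_i1] := perfect_i.
have /and4P[match_i1 acyc_i1 cov_i1 cyc_i2] := perfect_i1.
apply/injmP=> u v _ _ /hclass_eq[z dz].
have [a [w [y def_z]]] := normal_form z match_i1 cov_i1 cyc_i2 match_i2 acyc_i2.
have d_a : dS (gradient V a) = cycle_sum k cyc (u - v).
  rewrite linearB -[RHS]dz; move/(congr1 (@dS i.+2 k)): def_z.
  by rewrite !linearD /= dS_dS addr0 (dS_cycle_sum cyc_i2) addr0.
have a0 : gradient V a = 0.
  apply: (gradient_inj match_i1 acyc_i1).
  by move: (settled_cycle_sum cyc_i1 (u - v)); rewrite -d_a.
apply/rowP=> j; apply/eqP; rewrite -subr_eq0; apply/eqP.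
have := coef_cycle_sum cyc_i1 (u - v) j.
by rewrite -d_a a0 linear0 coef_zero !mxE => <-.
Qed.

(** The gradient in the normal form of a cycle has boundary zero, so it vanishes. *)
Lemma cycle_class_im :
  (cycle_class @* [set: 'rV['F_2]_(size (crit i.+1))])%g = HS i.+1 k.
Proof.
have /and4P[match_i acyc_i cov_i cyc_i1] := perfect_i.
have /and4P[match_i1 acyc_i1 _ _] := perfect_i1.
apply/setP=> X; apply/morphimP/morphimP=> [[v _ _ ->] | [x norm_x cycle_x ->]].
  exists (cycle_sum k cyc v); rewrite ?boundaries_norm //.
  by apply/cyclesP; rewrite (dS_cycle_sum cyc_i1).
have [a [v [y def_x]]] := normal_form x match_i cov_i cyc_i1 match_i1 acyc_i1.
exists v; rewrite ?inE //; apply/hclass_eq.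
have a0 : gradient V a = 0.
  apply: (gradient_inj match_i acyc_i) => t _.
  move/(congr1 (@dS i.+1 k)): def_x.
  rewrite !linearD /= dS_dS (cyclesP _ cycle_x) (dS_cycle_sum cyc_i1) !addr0 => <-.
  exact: coef_zero.
have def_v : cycle_sum k cyc v = x + dS y by rewrite def_x a0 add0r.
by exists (- y); rewrite linearN def_v opprD addrA subrr add0r.
Qed.

(** The classes of the critical cycles form a basis: they are independent because the
gradient is injective one degree higher, and they generate because a cycle has a
normal form. *)
Theorem morse_homology : HS i.+1 k \isog [set: 'rV['F_2]_(size (crit i.+1))].
Proof.
rewrite isog_sym -cycle_class_im.
exact: (sub_isog (subxx _) cycle_class_inj).
Qed.

End Homology.

(** * The matching on cacti *)

Definition erase (k : nat) (w : seq nat) : seq nat :=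
  foldr (fun a s => if (a == k) || (a == head 0 s) then s else a :: s)%N [::] w.

Definition past_last (a : nat) (w : seq nat) : nat := size w - index a (rev w).

Definition split_last (a k : nat) (w : seq nat) : seq nat :=
  let n := past_last a w in take n w ++ k :: a :: drop n w.

(** Over a word w of S(k-1), the lobe k can be at a gap of w, slide along a letter a
of w (a k a), or touch both sides of parts of w (k u_1 k ... u_r k). Every gap but
the first is collapsed: the gap after an occurrence of a other than the last with
the sliding of k along this occurrence, and the gap after the last a with the
word in which k touches both sides of the part between the first and the last a.
If, in k u_1 k ... u_r k, the part u_1 continues beyond the last occurrence of its
first letter, then a further k can be inserted there, and the two words are
matched. Over w there remain k w, with k at the first gap, and the slidings along
the last occurrence of each letter; these are matched as w is in S(k-1). *)
Fixpoint up (k : nat) (w : seq nat) : option (seq nat) :=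
  if k is k'.+1 then
    let l := take (index k w) w in let r := drop (index k w).+1 w in
    if k \in r then
      (* The word is l k u k ... *)
      let u := take (index k r) r in let n := past_last (head 0%N u) u in
      if n == size u then None else Some (l ++ k :: take n r ++ k :: drop n r)
    else if nilp l then omap (cons k) (up k' (erase k w))
    else
      let a := last 0%N l in
      if head 0%N r == a then
        if a \in behead r then None
        else omap (split_last a k) (up k' (erase k w))
      else if a \in r then Some (l ++ k :: a :: r)
      else let j := index a l in Some (take j l ++ k :: drop j l ++ k :: r)
  else None.

(** A new lobe either sits at the first gap or slides along the last occurrence of an
older letter. *)
Fixpoint critical_words (k : nat) : seq (seq nat) :=
  if k is k'.+1 then
    flatten [seq (k :: w) :: [seq split_last a k w | a <- iota 1 k']
            | w <- critical_words k']
  else [:: [::]].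

Definition critical (k i : nat) : seq (seq nat) :=
  [seq c <- critical_words k | size c == i + k]%N.

Definition cancel_pairs (l : seq (seq nat)) : seq (seq nat) :=
  [seq s <- undup l | odd (count_mem s l)].

(** The sum of the gradients met when a chain is pushed along gradient paths until
it is settled. What is left of a null-homologous cycle is a settled boundary, hence
zero, so the cycle is the boundary of its flow. The argument n bounds the length of
the paths. *)
Fixpoint flow (k n : nat) (l : seq (seq nat)) : seq (seq nat) :=
  if n is n'.+1 then
    let l' := [seq s <- l | up k s] in let ys := pmap (up k) l' in
    ys ++ flow k n' (cancel_pairs (l' ++ bdry k ys))
  else [::].

(** A bound for the number of edges of the gradient paths in S(4). *)
Definition path_bound : nat := 20.

Definition cycle_of (k : nat) (c : seq nat) : seq (seq nat) :=
  c :: cancel_pairs (flow k path_bound (bdry k [:: c])).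

(** S(4) is zero above degree 3, so the matching is checked in the degrees 1 to 3. *)
Lemma perfect_1 : perfect 4 (up 4) (critical 4) (cycle_of 4) 1.
Proof. by vm_compute. Qed.

Lemma perfect_2 : perfect 4 (up 4) (critical 4) (cycle_of 4) 2.
Proof. by vm_compute. Qed.

Lemma matched_3 : matched 4 (up 4) 3.
Proof. by vm_compute. Qed.

Lemma acyclic_3 : acyclic 4 (up 4) 3.
Proof. by vm_compute. Qed.

(** The count is 1*2 + 1*3 + 2*3. *)
Lemma size_critical : size (critical 4 2) = 11%N.
Proof. by vm_compute. Qed.

Lemma H2_S4 : HS 2 4 \isog [set: 'rV['F_2]_11].
Proof.
by have := morse_homology perfect_1 perfect_2 matched_3 acyclic_3; rewrite size_critical.
Qed.

(** * The operations on homology classes *)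

Definition comp_list (a p b q i : nat) (l1 l2 : seq (seq nat)) : seq (seq nat) :=
  flatten [seq comp_words q i s t | s <- [seq s <- l1 | valid a p s],
                                    t <- [seq t <- l2 | valid b q t]].

Lemma ocompE a p b q i (x : SOp a p) (y : SOp b q) :
  ocomp i x y =
  lin (fun s => lin (fun t => formal (a + b) (p + q - 1) (comp_words q i s t)) y) x.
Proof.
apply: eq_bigr => s _; rewrite scaler_sumr; apply: eq_bigr => t _.
by rewrite scalerA.
Qed.

Lemma ocomp_formal a p b q i l1 l2 :
  ocomp i (formal a p l1) (formal b q l2) =
  formal (a + b) (p + q - 1) (comp_list a p b q i l1 l2).
Proof.
rewrite ocompE lin_formal -big_filter /comp_list.
elim: (filter _ l1) => [|s l IHl]; first by rewrite big_nil formal_nil.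
by rewrite big_cons IHl formal_lin /= flatten_cat formal_cat.
Qed.

(** With this order of the arguments, composition with a fixed y is a linear map. *)
Definition ocomp_left a p b q i (y : SOp b q) (x : SOp a p) := ocomp i x y.

Lemma ocomp_left_is_linear a p b q i (y : SOp b q) :
  linear (@ocomp_left a p b q i y).
Proof. by move=> c x x'; rewrite /ocomp_left !ocompE linearP. Qed.

HB.instance Definition _ a p b q i y :=
  GRing.isLinear.Build 'F_2 (SOp a p) (SOp (a + b) (p + q - 1)) *:%R
    (@ocomp_left a p b q i y) (@ocomp_left_is_linear a p b q i y).

Lemma eq_linear i k (W : lmodType 'F_2) (f g : {linear SOp i k -> W}) :
  (forall s, valid i k s -> f (formal i k [:: s]) = g (formal i k [:: s])) -> f =1 g.
Proof.
move=> eq_fg x; rewrite [x]chain_sum !linear_sum; apply: eq_bigr => t _.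
by rewrite !linearZ /= eq_fg ?word_valid.
Qed.

Fixpoint pi_words (a p : nat) (t : planar a p) : seq (seq nat) :=
  match t with
  | PGen Gm => [:: [:: 1; 2]]
  | PGen Gb => [:: [:: 1; 2; 1]; [:: 2; 1; 2]]
  | PGen GA => [::]
  | PGen GB => [:: [:: 2; 1; 3; 1; 2]; [:: 2; 3; 1; 3; 2];
                   [:: 1; 2; 1; 3; 1]; [:: 3; 1; 3; 2; 3]]
  | PId => [:: [:: 1]]
  | PZero _ _ => [::]
  | PAdd _ _ t1 t2 => pi_words t1 ++ pi_words t2
  | PComp a p b q i t1 t2 => comp_list a p b q i (pi_words t1) (pi_words t2)
  end%N.

Lemma pi_mapE a p (t : planar a p) : pi_map t = formal a p (pi_words t).
Proof.
elim: t => {a p} [g||a p|a p t1 IH1 t2 IH2|a p b q i t1 IH1 t2 IH2] /=.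
- by case: g => //=; rewrite formal_nil.
- by [].
- by rewrite formal_nil.
- by rewrite IH1 IH2 formal_cat.
- by rewrite IH1 IH2 ocomp_formal.
Qed.

(** The Leibniz rule for composition with a fixed cycle, on the basis. *)
Definition comp_boundary (a p b q i : nat) (l : seq (seq nat)) : bool :=
  all (fun u => let ul := comp_list a.+1 p b q i [:: u] l in
         all (valid (a + b).+1 (p + q - 1)) ul &&
         same_parity (comp_list a p b q i (bdry p [:: u]) l) (bdry (p + q - 1) ul))
      (words a.+1 p).

Lemma ocomp_boundary a p b q i l (u : SOp a.+1 p) : comp_boundary a p b q i l ->
  ocomp i (dS u) (formal b q l) = dS (ocomp i u (formal b q l)).
Proof.
move=> /allP comp_l; set y := formal b q l.
apply: (eq_linear (f := @ocomp_left a p b q i y \o @dS a.+1 p)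
                  (g := @dS (a + b).+1 _ \o @ocomp_left a.+1 p b q i y)) => s val_s /=.
rewrite /ocomp_left dS_formal ?[all _ _]/= ?val_s // !ocomp_formal.
have /andP[valid_sl eq_sl] := comp_l s (etrans (mem_words _ _ _) val_s).
by rewrite (eq_formal _ _ eq_sl); exact (esym (dS_formal valid_sl)).
Qed.

Lemma no_boundary i k (x : SOp i k) : nilp (words i.+1 k) -> repr (hclass x) = x.
Proof.
move=> /nilP no_words; have [y ->] := repr_hclass x.
rewrite [y]chain_sum big1 ?linear0 ?addr0 // => t _.
by have := word_valid t; rewrite -mem_words no_words.
Qed.

(** The second factor is its own only representative; a change of the first one by a
boundary changes the composite by a boundary. *)
Lemma hcomp_hclass a p b q i (x : SOp a p) l :
  nilp (words b.+1 q) -> comp_boundary a p b q i l ->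
  hcomp i (hclass x) (hclass (formal b q l)) = hclass (ocomp i x (formal b q l)).
Proof.
move=> no_words comp_l; rewrite /hcomp (no_boundary _ no_words).
have [u ->] := repr_hclass x; apply/hclass_eq.
exists (ocomp i u (formal b q l)); rewrite -ocomp_boundary //.
rewrite -[ocomp i (x + _) _]/(ocomp_left i (formal b q l) (x + dS u)) linearD.
by rewrite addrC addKr.
Qed.

Definition inverse_on (k : nat) (f g : nat -> nat) : bool :=
  all (fun v => (f v \in iota 1 k) && (g (f v) == v)) (iota 1 k).

Lemma is_cactus_map k f g s : inverse_on k f g -> inverse_on k g f ->
  is_cactus k s -> is_cactus k [seq f v | v <- s].
Proof.
move=> /allP fg /allP gf /and4P[/allP k_s /allP s_k red_s /allrelP no_abab].
have f_k v : v \in s -> f v \in iota 1 k by move=> /k_s/fg/andP[].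
have fK v : v \in s -> g (f v) = v by move=> /k_s/fg/andP[_ /eqP].
have mapK : [seq g v | v <- [seq f v | v <- s]] = s.
  by rewrite -map_comp; apply: map_id_in.
apply/and4P; split.
- by apply/allP=> _ /mapP[v s_v ->]; apply: f_k.
- apply/allP=> v /gf/andP[k_gv /eqP <-].
  by apply: map_f; apply: s_k.
- apply: (homo_sorted_in (P := mem s)) red_s; last exact/allP.
  by move=> v w s_v s_w; apply: contraNneq => eq_f; rewrite -[v]fK // eq_f fK.
apply/allrelP=> _ _ /mapP[v s_v ->] /mapP[w s_w ->].
apply/implyP=> neq_f; have neq_vw : v != w by apply: contraNneq neq_f => ->.
have := no_abab v w s_v s_w; rewrite neq_vw; apply: contra => /(map_subseq g).
by rewrite mapK /= !fK.
Qed.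

Lemma removals_map f s :
  removals [seq f v | v <- s] = [seq [seq f v | v <- r] | r <- removals s].
Proof.
rewrite /removals size_map -map_comp; apply: eq_map => j /=.
by rewrite map_cat map_take map_drop.
Qed.

(** The inverse relabelling brings cacti back, so a discarded face stays discarded
after relabelling. *)
Lemma valid_map i k f g s : inverse_on k f g -> inverse_on k g f ->
  {subset s <= iota 1 k} -> valid i k [seq f v | v <- s] = valid i k s.
Proof.
move=> fg gf k_s; rewrite /valid size_map; congr (_ && _).
apply/idP/idP; last exact: is_cactus_map fg gf.
move/(is_cactus_map gf fg); rewrite -map_comp map_id_in // => v /k_s.
by case/(allP fg)/andP=> _ /eqP.
Qed.

Lemma relabel_is_linear i k f : linear (@relabel i k f).
Proof. exact: (lin_is_linear (fun s => formal i k [:: [seq f v | v <- s]])). Qed.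

HB.instance Definition _ i k f :=
  GRing.isLinear.Build 'F_2 (SOp i k) (SOp i k) *:%R (@relabel i k f)
    (@relabel_is_linear i k f).

Lemma relabel_formal i k f l :
  relabel f (formal i k l) =
  formal i k [seq [seq f v | v <- s] | s <- l & valid i k s].
Proof.
rewrite [LHS](formal_lin _ _ _ _ (fun s => [:: [seq f v | v <- s]])).
by congr (formal i k _); elim: (filter _ _) => //= s {}l ->.
Qed.

Lemma dS_relabel i k f g (x : SOp i.+1 k) : inverse_on k f g -> inverse_on k g f ->
  dS (relabel f x) = relabel f (dS x).
Proof.
move=> fg gf; apply: (eq_linear (f := @dS i.+1 k \o @relabel i.+1 k f)
                                (g := @relabel i k f \o @dS i.+1 k)) => s val_s /=.
have k_s : {subset s <= iota 1 k} by case/andP: val_s => _ /and4P[/allP].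
rewrite relabel_formal /= val_s [dS (formal _ _ [:: s])](formal_lin _ _ _ _ removals).
rewrite [LHS](formal_lin _ _ _ _ removals) /= (valid_map _ fg gf) // val_s /= !cats0.
rewrite [RHS]relabel_formal removals_map; apply: coef_inj => t; rewrite !coef_formal.
congr _%:R.
rewrite count_map [RHS]count_map count_filter; apply: eq_in_count => r s_r /=.
apply/eqP/andP=> [map_r | [/eqP //]]; rewrite map_r eqxx; split=> //.
rewrite -(valid_map i fg gf) ?map_r ?word_valid // => v r_v.
by apply: k_s; apply: mem_subseq r_v; case: (removals_subseq s_r).
Qed.

Lemma eq_relabel i k f g (x : SOp i k) :
  {in iota 1 k, f =1 g} -> relabel f x = relabel g x.
Proof.
move=> eq_fg; apply: eq_bigr => s _; congr (_ *: formal i k [:: _]).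
have /andP[_ /and4P[/allP k_s _ _ _]] := word_valid s.
by apply/eq_in_map => v s_v; apply: eq_fg; apply: k_s.
Qed.

Lemma hrelabel_hclass i k f g (x : SOp i k) : inverse_on k f g -> inverse_on k g f ->
  hrelabel f (hclass x) = hclass (relabel f x).
Proof.
move=> fg gf; have [y repr_x] := repr_hclass x; rewrite /hrelabel repr_x.
apply/hclass_eq; exists (relabel f y).
by rewrite (dS_relabel _ fg gf) linearD addrC addKr.
Qed.

Lemma eq_hrelabel i k f g (X : coset_of (boundaries i k)) :
  {in iota 1 k, f =1 g} -> hrelabel f X = hrelabel g X.
Proof. by move=> eq_fg; rewrite /hrelabel (eq_relabel _ eq_fg). Qed.

(** * The class of pi d(C) *)

Definition dC_words : seq (seq nat) := cancel_pairs (pi_words dC).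

Lemma pi_dC : pi_map dC = formal 2 4 dC_words.
Proof. by rewrite pi_mapE; apply: eq_formal; vm_compute. Qed.

Lemma dS_pi_dC : dS (pi_map dC) = 0.
Proof.
rewrite pi_dC dS_formal; last by vm_compute.
by rewrite -(formal_nil 1 4); apply: eq_formal; vm_compute.
Qed.

(** The cycle (243), and also the order in which the variables occur in
[x_1,x_4][x_2,x_3]. *)
Definition sigma (v : nat) : nat := nth 0%N [:: 1; 4; 2; 3]%N v.-1.
Definition sigma_inv (v : nat) : nat := nth 0%N [:: 1; 3; 4; 2]%N v.-1.

Definition bracket_words : seq (seq nat) := [:: [:: 1; 2; 1]; [:: 2; 1; 2]]%N.

Definition mbb_words : seq (seq nat) :=
  comp_list 1 3 1 2 1 (comp_list 0 2 1 2 2 [:: [:: 1; 2]]%N bracket_words)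
    bracket_words.

Lemma hcomp_mbb : hcomp 1 (hcomp 2 hm hb) hb = hclass (formal 2 4 mbb_words).
Proof.
rewrite /hb /chain_b (hcomp_hclass chain_m); [|by vm_compute|by vm_compute].
rewrite hcomp_hclass; [|by vm_compute|by vm_compute].
by rewrite /chain_m 2!ocomp_formal.
Qed.

(** A bracket of two variables is read as b with the unit plugged into both inputs. *)
Lemma hcomp_b_units : hcomp 1 (hcomp 2 hb hunit) hunit = hb.
Proof.
rewrite /hunit /chain_unit (hcomp_hclass chain_b); [|by vm_compute|by vm_compute].
rewrite hcomp_hclass; [|by vm_compute|by vm_compute].
by rewrite {1}/chain_b 2!ocomp_formal.
Qed.

Lemma perm_val_cycle243 : {in iota 1 4, perm_val cycle243 =1 sigma}.
Proof. by apply/eq_in_map; rewrite cycle243E. Qed.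

Definition target_words : seq (seq nat) :=
  [seq [seq sigma v | v <- s] | s <- mbb_words].

Lemma hrelabel_mbb :
  hrelabel sigma (hcomp 1 (hcomp 2 hm hb) hb) = hclass (formal 2 4 target_words).
Proof.
rewrite hcomp_mbb (hrelabel_hclass (g := sigma_inv)) // relabel_formal.
by congr hclass; apply: eq_formal; vm_compute.
Qed.

Definition filling : seq (seq nat) :=
  cancel_pairs (flow 4 path_bound (cancel_pairs (dC_words ++ target_words))).

(** The two cycles have the same normal form, so that their sum is the boundary of
its flow. *)
Lemma alphaC_eq : alphaC = hclass (formal 2 4 target_words).
Proof.
rewrite /alphaC pi_dC; apply/hclass_eq; exists (formal 3 4 filling).
rewrite dS_formal; last by vm_compute.
have -> : - formal 2 4 target_words = formal 2 4 target_words.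
  apply/eqP; rewrite -subr_eq0 -opprD oppr_eq0 -formal_cat -(formal_nil 2 4).
  by apply/eqP/eq_formal; vm_compute.
by rewrite -formal_cat; apply: eq_formal; vm_compute.
Qed.

Theorem lemma5p1 :
  [/\ dS (pi_map dC) = 0%R,
      alphaC \in HS 2 4,
      alphaC = hact cycle243 (hcomp 1 (hcomp 2 hm hb) hb),
      alphaC = gerst_class (GMul (GBr (GVar 1) (GVar 4))
                                 (GBr (GVar 2) (GVar 3)))
    & HS 2 4 \isog [set: 'rV['F_2]_11]].
Proof.
split.
- exact: dS_pi_dC.
- by apply: mem_quotient; apply/cyclesP; exact: dS_pi_dC.
- by rewrite alphaC_eq -hrelabel_mbb; apply/esym/eq_hrelabel/perm_val_cycle243.
- rewrite alphaC_eq -hrelabel_mbb.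
  (* Evaluates the monomial, its dimension and its arity. *)
  pose bracket : coset_of (boundaries 1 2) := hcomp 1 (hcomp 2 hb hunit) hunit.
  change (hrelabel sigma (hcomp 1 (hcomp 2 hm hb) hb) =
          hrelabel sigma (hcomp 1 (hcomp 2 hm bracket) bracket)
            :> coset_of (boundaries 2 4)).
  by rewrite /bracket hcomp_b_units.
- exact: H2_S4.
Qed.
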